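(* Let $(x_k)_{k\in\mathbb N}\subset\mathcal M_h$ be the (infinite) sequence of iterates generated by the two-level Riemannian optimization algorithm described in the context, with search directions $d_k\in\mathrm T_{x_k}\mathcal M_h$, step sizes $\alpha_k>0$ and $x_{k+1}=\mathcal R^h_{x_k}(\alpha_kd_k)$. Let $\mathcal K_G=\{k\in\mathbb N: d_k=-\operatorname{grad}f_h(x_k)\}$. Assume: (A1) for every $x_0\in\mathcal M_h$ the sublevel set $\mathcal S_{x_0}=\{x\in\mathcal M_h: f_h(x)\le f_h(x_0)\}$ is compact; (A2) $f_h\in C^1(\mathcal M_h)$ and $f_h$ is bounded below on $\mathcal M_h$; (A3) the pullback $f_h\circ\mathcal R^h_x$ is uniformly Lipschitz continuously differentiable on $\mathcal S_{x_0}$ ($x_0$ being the initial point): there is $L_{f_h}>0$ such that for all $x\in\mathcal S_{x_0}$ and all $v_1,v_2\in\mathrm T_x\mathcal M_h$, $$\|\nabla f_h(\mathcal R^h_x(v_1))-\nabla f_h(\mathcal R^h_x(v_2))\|_x\le L_{f_h}\|v_1-v_2\|_x,$$ where $\nabla f_h(\mathcal R_x^h(v))$ denotes the gradient of the function $f_h\circ\mathcal R_x^h:\mathrm T_x\mathcal M_h\to\mathbb R$ at $v$ with respect to the inner product $\langle\cdot,\cdot\rangle_x$ on $\mathrm T_x\mathcal M_h$; (A4) the step sizes satisfy the Riemannian Wolfe conditions: with constants $0<c_1<c_2<1$, for all $k$, $$f_h(x_{k+1})-f_h(x_k)\le c_1\alpha_k\langle\operatorname{grad}f_h(x_k),d_k\rangle_{x_k},$$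 $$\big\langle\operatorname{grad}f_h(x_{k+1}),\mathrm D\mathcal R^h_{x_k}(\alpha_kd_k)[d_k]\big\rangle_{x_{k+1}}\ge c_2\langle\operatorname{grad}f_h(x_k),d_k\rangle_{x_k};$$ (A5) there is $\alpha_{\max}>0$ such that $\alpha_k\le\alpha_{\max}$ for all $k\in\mathcal K_G$. Then $$\lim_{k\to\infty}\|\operatorname{grad}f_h(x_k)\|_{x_k}=0 .$$
   Context: Setting. $V_H,V_h$ are finite-dimensional Euclidean spaces; $\mathcal M_H\subset V_H$ (coarse) and $\mathcal M_h\subset V_h$ (fine) are Riemannian manifolds with metrics $\langle\cdot,\cdot\rangle_y$, $\langle\cdot,\cdot\rangle_x$ and induced norms $\|\cdot\|_y$, $\|\cdot\|_x$. $f_H:\mathcal M_H\to\mathbb R$, $f_h:\mathcal M_h\to\mathbb R$ are continuously differentiable, with Riemannian gradients $\operatorname{grad}f_H$, $\operatorname{grad}f_h$. $\mathcal R^h,\mathcal R^H$ are retractions on $\mathcal M_h,\mathcal M_H$: a retraction on $\mathcal M$ is a smooth map $\mathcal R:\mathrm T\mathcal M\to\mathcal M$, $(x,v)\mapsto\mathcal R_x(v)$, with $\mathcal R_x(0)=x$ and $\mathrm D\mathcal R_x(0)=\mathrm{id}_{\mathrm T_x\mathcal M}$ for all $x$, where $\mathrm D\mathcal R_x(v):\mathrm T_x\mathcal M\to\mathrm T_{\mathcal R_x(v)}\mathcal M$ is the differential of $\mathcal R_x$ at $v$. $\mathcal L^H_y=(\mathcal R^H_y)^{-1}$ is the lifting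 map, the smooth local inverse of $\mathcal R^H_y$ defined on an open neighborhood $\mathcal U_y$ of $y$ with $\mathcal L^H_y(y)=0$. A set $\mathcal C\subset\mathcal M_H$ is $\mathcal R^H$-convex if for all $a,b\in\mathcal C$ the vector $v=\mathcal L^H_a(b)$ exists and $\mathcal R^H_a(tv)\in\mathcal C$ for all $t\in[0,1]$. For each $y$ arising below, $\mathcal C_y\subset\mathcal U_y$ is an $\mathcal R^H$-convex set containing $y$. Transfer maps. $r:\mathrm{dom}(r)\subseteq\mathcal M_h\to\mathcal M_H$ is a point restriction (smooth, surjective, with surjective differential at every point). For $x\in\mathcal M_h$, $y\in\mathcal M_H$, $P_y^x:\mathrm T_y\mathcal M_H\to\mathrm T_x\mathcal M_h$ is an injective linear map and $R_x^y:\mathrm T_x\mathcal M_h\to\mathrm T_y\mathcal M_H$ a surjective linear map with $\langle P_y^xu,v\rangle_x=\langle u,R_x^yv\rangle_y$ for all $u,v$. Two-level Riemannian optimization algorithm. Input: the data above, constants $\eta\in(0,1)$, $\mu>0$, and an initial point $x_0\in\mathrm{dom}(r)$. For $k=0,1,2,\dots$: 1. If, with $y_k=r(x_k)$, the coarse model condition $\|R_{x_k}^{y_k}(\operatorname{grad}f_h(x_k))\|_{y_k}\ge\max(\eta\|\operatorname{grad}f_h(x_k)\|_{x_k},\mu)$ holds and ($k=0$ or $d_{k-1}=-\operatorname{grad}f_h(x_{k-1})$), perform a coarse correction step: compute $\tilde z_k\in\mathcal C_{y_k}$ with $q_k(\tilde z_k)<q_k(y_k)$, where $$q_k(z)=f_H(z)-\big\langle\operatorname{grad}f_H(y_k)-R_{x_k}^{y_k}(\operatorname{grad}f_h(x_k)),\mathcal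 L^H_{y_k}(z)\big\rangle_{y_k},\quad z\in\mathcal C_{y_k},$$ and set $d_k=P_{y_k}^{x_k}(\mathcal L^H_{y_k}(\tilde z_k))$. 2. Otherwise perform a gradient step: $d_k=-\operatorname{grad}f_h(x_k)$. 3. Choose $\alpha_k>0$ with $f_h(\mathcal R^h_{x_k}(\alpha_kd_k))<f_h(x_k)$ and $\mathcal R^h_{x_k}(\alpha_kd_k)\in\mathrm{dom}(r)$, and set $x_{k+1}=\mathcal R^h_{x_k}(\alpha_kd_k)$. The algorithm terminates if it reaches a stationary point of $f_h$. It is a standing assumption that every search direction is either of G-type ($d_k=-\operatorname{grad}f_h(x_k)$) or of C-type ($d_k\ne-\operatorname{grad}f_h(x_k)$ and $d_k$ is a descent direction, i.e. $\langle\operatorname{grad}f_h(x_k),d_k\rangle_{x_k}<0$); a coarse correction direction that is not a descent direction is replaced by $-\operatorname{grad}f_h(x_k)$. By construction no two consecutive steps are of C-type: if $k\ge1$ and $d_k$ is of C-type, then $d_{k-1}=-\operatorname{grad}f_h(x_{k-1})$. *)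

(* Defs.v *)
(* The ambient Euclidean spaces are 'rV[R]_n. Objects that
   live on a manifold (functions, metrics, retractions, transfer maps) are total
   functions on the ambient spaces of which only the values on the manifold and
   on its tangent spaces are ever constrained or used. *)
From mathcomp Require Export all_boot all_order all_algebra.
From mathcomp Require Export all_classical all_reals all_analysis.
Export Order.TTheory GRing.Theory Num.Theory.
Export numFieldNormedType.Exports.

Set Implicit Arguments.
Unset Strict Implicit.
Unset Printing Implicit Defensive.

Global Open Scope classical_set_scope.
Global Open Scope ring_scope.

(* In finite dimension, C^(k+1) means: differentiable with every directional
   derivative of class C^k. *)
Fixpoint Ck (R : realType) (V W : normedModType R) (k : nat) (U : set V)
    (f : V -> W) : Prop :=
  match k with
  | 0 => forall x, U x -> {for x, continuous f}
  | k'.+1 => (forall x, U x -> differentiable f x) /\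
             (forall v : V, Ck k' U (fun x => 'D_v f x))
  end.

(* C^k on an arbitrary subset A: locally the restriction of an ambient C^k map. *)
Definition Ck_on (R : realType) (V W : normedModType R) (k : nat) (A : set V)
    (f : V -> W) : Prop :=
  forall x, A x -> exists (U : set V) (F : V -> W),
    [/\ open U, U x, Ck k U F & forall z, U z -> A z -> F z = f z].

Definition smooth (R : realType) (V W : normedModType R) (U : set V)
    (f : V -> W) : Prop :=
  forall k, Ck k U f.

Definition smooth_on (R : realType) (V W : normedModType R) (A : set V)
    (f : V -> W) : Prop :=
  forall x, A x -> exists (U : set V) (F : V -> W),
    [/\ open U, U x, smooth U F & forall z, U z -> A z -> F z = f z].

(* Embedded d-dimensional submanifold, by slice charts: around each of its
   points, a diffeomorphism phi (with inverse psi) between open sets maps M to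
   R^d x {0}. *)
Definition is_submanifold (R : realType) (n d : nat) (M : set 'rV[R]_n) : Prop :=
  (d <= n)%N /\
  forall x, M x ->
  exists (U W : set 'rV[R]_n) (phi psi : 'rV[R]_n -> 'rV[R]_n),
    [/\ open U, U x & open W] /\
    [/\ smooth U phi, smooth W psi, set_fun U W phi & set_fun W U psi] /\
    [/\ (forall z, U z -> psi (phi z) = z),
        (forall w, W w -> phi (psi w) = w) &
        (forall z, U z ->
           (M z <-> forall i : 'I_n, (d <= i)%N -> phi z ord0 i = 0))].

Definition is_curve (R : realType) (V : normedModType R) (A : set V) (x v : V)
    (c : R -> V) : Prop :=
  exists2 e : R, 0 < e &
    [/\ smooth (ball (0 : R) e) c, (forall t, ball (0 : R) e t -> A (c t)),
        c 0 = x & is_derive (0 : R) (1 : R) c v].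

Definition tangent (R : realType) (V : normedModType R) (A : set V) (x : V) :
    set V :=
  [set v | exists c, is_curve A x v c].

Definition tangent_bundle (R : realType) (V : normedModType R) (A : set V) :
    set (V * V) :=
  [set p | A p.1 /\ tangent A p.1 p.2].

(* D f(x)[v] for f defined on A: the velocity at 0 of f \o c, for a curve c in A
   through x with velocity v (for differentiable f it does not depend on c). *)
Definition mdiff (R : realType) (V W : normedModType R) (A : set V) (f : V -> W)
    (x v : V) : W :=
  xget 0 [set w | exists2 c, is_curve A x v c &
                  is_derive (0 : R) (1 : R) (f \o c) w].

(* ip z u v is the inner product of u and v in the tangent space of A at z. *)
Definition riem_grad (R : realType) (V : normedModType R) (A : set V)
    (ip : V -> V -> V -> R) (f : V -> R) (x : V) : V :=
  xget 0 [set u | tangent A x u /\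
                  forall v, tangent A x v -> ip x u v = mdiff A f x v].

Definition gnorm (R : realType) (V : normedModType R) (ip : V -> V -> V -> R)
    (x v : V) : R :=
  Num.sqrt (ip x v v).

(* The metric varies smoothly: (x, u, v) |-> <u, v>_x is smooth on the Whitney
   sum TM (+) TM. *)
Definition is_metric (R : realType) (V : normedModType R) (M : set V)
    (g : V -> V -> V -> R) : Prop :=
  (forall x, M x ->
     [/\ (forall u v, tangent M x u -> tangent M x v -> g x u v = g x v u),
         (forall (a : R) u v w, tangent M x u -> tangent M x v ->
            tangent M x w -> g x (a *: u + v) w = a * g x u w + g x v w) &
         (forall u, tangent M x u -> u != 0 -> 0 < g x u u)]) /\
  smooth_on [set p : V * V * V |
               M p.1.1 /\ (tangent M p.1.1 p.1.2 /\ tangent M p.1.1 p.2)]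
            (fun p : V * V * V => g p.1.1 p.1.2 p.2).

Definition riemannian_submanifold (R : realType) (n d : nat)
    (M : set 'rV[R]_n) (g : 'rV[R]_n -> 'rV[R]_n -> 'rV[R]_n -> R) : Prop :=
  is_submanifold d M /\ is_metric M g.

(* The differential of ret x at v is taken on the manifold tangent M x. *)
Definition is_retraction (R : realType) (V : normedModType R) (M : set V)
    (ret : V -> V -> V) : Prop :=
  [/\ smooth_on (tangent_bundle M) (fun p : V * V => ret p.1 p.2),
      (forall x v, M x -> tangent M x v -> M (ret x v)),
      (forall x, M x -> ret x 0 = x) &
      (forall x v, M x -> tangent M x v ->
         mdiff (tangent M x) (ret x) 0 v = v)].

Definition is_lifting (R : realType) (V : normedModType R) (M : set V)
    (ret : V -> V -> V) (U : V -> set V) (lift : V -> V -> V) : Prop :=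
  forall y, M y ->
    [/\ (exists2 O : set V, open O & U y = O `&` M), U y y &
        smooth_on (U y) (lift y)] /\
    [/\ (forall z, U y z -> tangent M y (lift y z)),
        (forall z, U y z -> ret y (lift y z) = z) &
        lift y y = 0].

Definition retraction_convex (R : realType) (V : normedModType R) (M : set V)
    (ret : V -> V -> V) (U : V -> set V) (lift : V -> V -> V)
    (C : set V) : Prop :=
  C `<=` M /\
  forall a b, C a -> C b ->
    U a b /\ forall t : R, 0 <= t <= 1 -> C (ret a (t *: lift a b)).

(* For dom open in Mh, tangent dom x is the tangent space of Mh at x. *)
Definition point_restriction (R : realType) (Vh VH : normedModType R)
    (Mh : set Vh) (MH : set VH) (dom : set Vh) (r : Vh -> VH) : Prop :=
  [/\ dom `<=` Mh, set_fun dom MH r, smooth_on dom r, set_surj dom MH r &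
      forall x, dom x ->
        set_surj (tangent dom x) (tangent MH (r x)) (mdiff dom r x)].

Definition linear_between (R : realType) (V W : normedModType R) (A : set V)
    (B : set W) (f : V -> W) : Prop :=
  set_fun A B f /\
  forall (a : R) u v, A u -> A v -> f (a *: u + v) = a *: f u + f v.

(* P y x : T_y MH -> T_x Mh and Rs x y : T_x Mh -> T_y MH. *)
Definition vector_transfer (R : realType) (Vh VH : normedModType R)
    (Mh : set Vh) (gh : Vh -> Vh -> Vh -> R)
    (MH : set VH) (gH : VH -> VH -> VH -> R)
    (P : VH -> Vh -> VH -> Vh) (Rs : Vh -> VH -> Vh -> VH) : Prop :=
  forall x y, Mh x -> MH y ->
    [/\ linear_between (tangent MH y) (tangent Mh x) (P y x),
        set_inj (tangent MH y) (P y x),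
        linear_between (tangent Mh x) (tangent MH y) (Rs x y),
        set_surj (tangent Mh x) (tangent MH y) (Rs x y) &
        forall u v, tangent MH y u -> tangent Mh x v ->
          gh x (P y x u) v = gH y u (Rs x y v)].

(* The coarse model q at the fine point x, with y = r x. *)
Definition coarse_model (R : realType) (Vh VH : normedModType R)
    (Mh : set Vh) (gh : Vh -> Vh -> Vh -> R) (fh : Vh -> R)
    (MH : set VH) (gH : VH -> VH -> VH -> R) (fH : VH -> R)
    (liftH : VH -> VH -> VH) (Rs : Vh -> VH -> Vh -> VH)
    (x : Vh) (y z : VH) : R :=
  fH z - gH y (riem_grad MH gH fH y - Rs x y (riem_grad Mh gh fh x)) (liftH y z).

(* An infinite run (x, d, alpha) of the two-level algorithm; a coarse correction
   that is not a descent direction is replaced by the negative gradient. *)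
Definition two_level_run (R : realType) (Vh VH : normedModType R)
    (Mh : set Vh) (gh : Vh -> Vh -> Vh -> R) (fh : Vh -> R)
    (reth : Vh -> Vh -> Vh)
    (MH : set VH) (gH : VH -> VH -> VH -> R) (fH : VH -> R)
    (liftH : VH -> VH -> VH) (C : VH -> set VH)
    (dom : set Vh) (r : Vh -> VH)
    (P : VH -> Vh -> VH -> Vh) (Rs : Vh -> VH -> Vh -> VH)
    (eta mu : R)
    (x d : nat -> Vh) (alpha : nat -> R) : Prop :=
  let grad k := riem_grad Mh gh fh (x k) in
  let y k := r (x k) in
  let q k := coarse_model Mh gh fh MH gH fH liftH Rs (x k) (y k) in
  let coarse k :=
    gnorm gH (y k) (Rs (x k) (y k) (grad k))
      >= Num.max (eta * gnorm gh (x k) (grad k)) mu /\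
    (forall j, k = j.+1 -> d j = - grad j) in
  dom (x 0%N) /\
  forall k,
    [/\ grad k <> 0,
        (coarse k -> exists z : VH,
           [/\ C (y k) z, q k z < q k (y k) &
               let dc := P (y k) (x k) (liftH (y k) z) in
               d k = if gh (x k) (grad k) dc < 0 then dc else - grad k]),
        (~ coarse k -> d k = - grad k) &
        [/\ 0 < alpha k, x k.+1 = reth (x k) (alpha k *: d k),
            fh (x k.+1) < fh (x k) & dom (x k.+1)]].

(* Main.v *)
From mathcomp Require Import ring lra.
Require Import Defs.

Set Implicit Arguments.
Unset Strict Implicit.
Unset Printing Implicit Defensive.

(** A gradient step that satisfies the Wolfe conditions cannot be short: the
    curvature condition and the Lipschitz bound on the pullback gradient force
    its step size to be at least (1 - c2) / L, and the sufficient decrease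
    condition then makes f drop by a fixed multiple of the squared gradient norm
    ([wolfe_gradient_decrease]).  Since f decreases along the whole run and is
    bounded below, the drops tend to zero, and so do the gradient norms at the
    iterates from which a gradient step is made.

    At any other iterate nothing is known about the direction or about the step
    that leaves it.  But such an iterate was reached by a gradient step, whose
    size is at most alpha_max and whose starting point has a small gradient.  The
    step is therefore short, and a short step of this kind cannot lead to a large
    gradient: on a compact set this holds uniformly ([gradient_step_compact]).
    The compact set is the initial sublevel set.

    The uniform statement is local by compactness ([gradient_step_near]).  Near a
    critical point p the gradient is small everywhere ([grad_near_critical]), the
    metric is bounded below by a multiple of the ambient norm
    ([metric_lower_bound]), and the retraction maps (z, u) close to p when z is
    close to p and u is small.  Near a point that is not critical the gradient is
    bounded away from zero ([grad_near_regular]), so that its smallness excludes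
    this case.

    All of this needs tangent spaces that are vector spaces and vary
    continuously; both are read off slice charts, in which the tangent space is
    the common kernel of the last coordinates of the differential of the chart.
    Riemannian gradients then exist by the Riesz representation theorem on the
    tangent space ([inner_riesz]). *)

(** * Derivatives along paths, and maps of class C^k *)

Section Calculus.
Context {R : realType}.
Implicit Types V W : normedModType R.

(** Velocities of differentiable paths suffice to compute differentials, and
    differentiable paths are stable under composition with differentiable maps;
    the smooth curves that define the tangent space are needed only to show that
    a vector is tangent. *)
Definition path_through V (A : set V) (x v : V) (c : R -> V) : Prop :=
  [/\ c 0 = x, (\forall t \near (0 : R), A (c t)) &
      is_derive (0 : R) (1 : R) c v].

Lemma curve_path V (A : set V) x v c : is_curve A x v c -> path_through A x v c.
Proof.
move=> [e e0 [_ cA c0 cv]]; split => //.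
by apply: filterS (nbhsx_ballx (0 : R) e e0) => t; exact: cA.
Qed.

Lemma is_derive_comp_diff V W (c : R -> V) (F : V -> W) (x v : V) :
  c 0 = x -> is_derive (0 : R) (1 : R) c v -> differentiable F x ->
  is_derive (0 : R) (1 : R) (F \o c) ('d F x v).
Proof.
move=> <- cv dF.
have dc : differentiable c 0 by apply/derivable1_diffP; case: cv.
have dFc : differentiable (F \o c) 0 by exact: differentiable_comp.
apply: DeriveDef; first exact/derivable1_diffP.
by rewrite deriveE// diff_comp//= -(deriveE _ dc); case: cv => _ ->.
Qed.

Lemma path_image V W (A : set V) (f F : V -> W) (x v : V) (c : R -> V) :
  path_through A x v c -> differentiable F x ->
  (\forall z \near x, A z -> F z = f z) ->
  is_derive (0 : R) (1 : R) (f \o c) ('d F x v).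
Proof.
move=> [<- cA cv] dF Ff.
apply: near_eq_is_derive (is_derive_comp_diff erefl cv dF).
have cc : {for 0, continuous c}.
  by apply: differentiable_continuous; apply/derivable1_diffP; case: cv.
have Ff' : \forall t \near (0 : R), A (c t) -> F (c t) = f (c t).
  exact: (cc _ Ff).
by apply: filterS2 Ff' cA => t Ft /Ft.
Qed.

Lemma is_derive_unique V W (x v : V) (f : V -> W) (a b : W) :
  is_derive x v f a -> is_derive x v f b -> a = b.
Proof. by move=> [_ <-] [_ <-]. Qed.

(** The choice made by [mdiff] is harmless as soon as all paths give the same
    derivative, and the tangency hypothesis provides one path. *)
Lemma mdiff_eq V W (A : set V) (f : V -> W) (x v : V) (w : W) :
  tangent A x v ->
  (forall c, path_through A x v c -> is_derive (0 : R) (1 : R) (f \o c) w) ->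
  mdiff A f x v = w.
Proof.
move=> [c cA] fw; rewrite /mdiff; case: xgetP => [y -> [c' c'A fy]|/(_ w)[]].
  exact: is_derive_unique fy (fw _ (curve_path c'A)).
by exists c => //; exact: fw (curve_path cA).
Qed.

Lemma mdiff_diff V W (A : set V) (f F : V -> W) (x v : V) :
  tangent A x v -> differentiable F x ->
  (\forall z \near x, A z -> F z = f z) ->
  mdiff A f x v = 'd F x v.
Proof.
by move=> xv dF Ff; apply: mdiff_eq => // c xc; exact: path_image dF Ff.
Qed.

(** The directional derivatives of F along a line are directional derivatives
    of F with a rescaled direction, already at the level of difference
    quotients; this is what lets the induction on k go through without a chain
    rule for C^k maps. *)
Lemma Ck_comp_line V W (k : nat) (U : set V) (F : V -> W) (a v : V) (e : R) :
  (forall t, ball (0 : R) e t -> U (a + t *: v)) -> Ck k U F ->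
  Ck k (ball (0 : R) e) (fun t : R => F (a + t *: v)).
Proof.
move=> aU; elim: k F => [|k IH] F /=.
  move=> FU t te; apply: continuous_comp; last exact/FU/aU.
  apply: cvgD; [exact: cvg_cst|].
  by apply: cvgZr_tmp; exact: cvg_id.
move=> [dF DF]; split=> [t te|u].
  rewrite -[fun _ => _]/(F \o (fun s : R => a + s *: v)).
  apply: differentiable_comp; last exact/dF/aU.
  by apply: differentiableD => //; exact: differentiableZl.
suff -> : (fun x => 'D_u (fun t : R => F (a + t *: v)) x) =
    (fun t : R => 'D_(u *: v) F (a + t *: v)) by exact: (IH _ (DF (u *: v))).
apply/funext => t; rewrite /derive.
have -> : (fun h : R => h^-1 *: (((fun s : R => F (a + s *: v)) \o shift t)
      (h *: u) - F (a + t *: v))) =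
    (fun h : R => h^-1 *: ((F \o shift (a + t *: v)) (h *: (u *: v)) -
      F (a + t *: v))).
  apply/funext => h /=; congr (_ *: (F _ - _)).
  by rewrite scalerDl addrCA -!scalerA.
by [].
Qed.

Lemma Ck_cst V W (k : nat) (U : set V) (a : W) : Ck k U (fun _ : V => a).
Proof.
elim: k a => [|k IH] a /=; first by move=> x _; exact: cst_continuous.
split=> [x _|v]; first exact: differentiable_cst.
have -> : (fun x => 'D_v (fun _ : V => a) x) = (fun=> 0).
  by apply/funext => x; rewrite derive_cst.
exact: IH.
Qed.

Lemma smooth_id V (U : set V) : smooth U (fun v : V => v).
Proof.
case=> [|k] /=; first by move=> x _.
split=> [x _|v]; first exact: ex_diff.
have -> : (fun x => 'D_v (fun u : V => u) x) = (fun=> v).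
  by apply/funext => x; rewrite derive_id.
exact: Ck_cst.
Qed.

End Calculus.

Section RowCalculus.
Context {R : realType} {n : nat}.
Implicit Types W : normedModType R.
Local Notation V := 'rV[R]_n.

Lemma cvg_sum W (T I : Type) (F : set_system T) {FF : Filter F} (r : seq I)
    (f : I -> T -> W) (a : I -> W) :
  (forall i, f i @ F --> a i) ->
  (fun t => \sum_(i <- r) f i t) @ F --> \sum_(i <- r) a i.
Proof.
move=> fa; elim: r => [|i r IH].
  rewrite big_nil [X in X @ _](_ : _ = fun=> 0); first exact: cvg_cst.
  by apply/funext => t; rewrite big_nil.
rewrite big_cons [X in X @ _](_ : _ = fun t => f i t + \sum_(j <- r) f j t).
  exact: cvgD.
by apply/funext => t; rewrite big_cons.
Qed.

Lemma diff_row W (F : V -> W) (z v : V) :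
  'd F z v = \sum_(i < n) v ord0 i *: 'd F (z) (delta_mx ord0 i).
Proof.
rewrite [in LHS](row_sum_delta v) linear_sum.
by apply: eq_bigr => i _; rewrite linearZ.
Qed.

(** The differential is a finite combination of partial derivatives, with
    the coordinates of the vector as coefficients. *)
Lemma C1_diff_continuous W (U : set V) (F : V -> W) (p v : V) :
  open U -> Ck 1 U F -> U p ->
  {for (p, v), continuous (fun q : V * V => 'd F (q.1) q.2)}.
Proof.
move=> oU [dF DF] Up.
suff : (fun q : V * V =>
    \sum_(i < n) q.2 ord0 i *: 'D_(delta_mx ord0 i) F q.1) @ (p, v) -->
    'd F p v.
  apply: cvg_trans; apply: near_eq_cvg.
  have nU : \forall q \near (p, v), U q.1.
    by apply: (@cvg_fst _ _ (nbhs p) (nbhs v)); exact: open_nbhs_nbhs.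
  near=> q; rewrite [RHS]diff_row; apply: eq_bigr => i _; rewrite deriveE//.
  by apply: dF; near: q.
rewrite [X in _ --> X]diff_row.
apply: cvg_sum => i; apply: cvgZ.
  apply: (@continuous_comp _ _ _ snd (fun u : V => u ord0 i) (p, v)).
    exact: cvg_snd.
  exact: coord_continuous.
rewrite -deriveE; last exact: dF.
have DFp := DF (delta_mx ord0 i) p Up.
exact: (@cvg_comp _ _ _ fst ('D_(delta_mx ord0 i) F) _ _ _ cvg_fst DFp).
Unshelve. all: by end_near. Qed.

End RowCalculus.

(** * Tangent spaces in slice charts *)

Lemma is_derive_line {R : realType} (V : normedModType R) (z v : V) :
  is_derive (0 : R) (1 : R) (fun t : R => z + t *: v) v.
Proof.
have dl : is_diff (0 : R) (fun t : R => z + t *: v) (0 + ( *:%R^~ v : R -> V)).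
  exact: is_diffD.
apply: DeriveDef; first exact/derivable1_diffP.
by rewrite deriveE// diff_val /= add0r scale1r.
Qed.

Section Chart.
Context {R : realType} {n : nat}.
Local Notation V := 'rV[R]_n.

Lemma diff_inverse (U : set V) (f g : V -> V) (z v : V) :
  open U -> U z -> (forall y, U y -> g (f y) = y) ->
  differentiable f z -> differentiable g (f z) ->
  'd g (f z) ('d f z v) = v.
Proof.
move=> oU Uz gf df dg.
have z0 : z + (0 : R) *: v = z by rewrite scale0r addr0.
have dc : is_derive (0 : R) (1 : R) (f \o (fun t : R => z + t *: v)) ('d f z v).
  by apply: is_derive_comp_diff => //; exact: is_derive_line.
have dgf : is_derive (0 : R) (1 : R) (g \o (f \o (fun t : R => z + t *: v)))
    ('d g (f z) ('d f z v)).
  by apply: is_derive_comp_diff => //=; rewrite z0.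
apply: is_derive_unique dgf _.
apply: near_eq_is_derive (is_derive_line z v).
have lc : {for (0 : R), continuous (fun t : R => z + t *: v)}.
  apply: differentiable_continuous; apply/derivable1_diffP.
  by case: (is_derive_line z v).
have nU : \forall y \near z + (0 : R) *: v, U y.
  by rewrite z0; exact: open_nbhs_nbhs.
have nUc : \forall t \near (0 : R), U (z + t *: v) by exact: (lc _ nU).
by apply: filterS nUc => t Ut /=; rewrite gf.
Qed.

Lemma path_coord0 (W : normedModType R) (A : set W) (F : W -> V) (x v : W)
    (c : R -> W) (i : 'I_n) :
  path_through A x v c -> differentiable F x ->
  (\forall z \near x, A z -> F z ord0 i = 0) -> 'd F x v ord0 i = 0.
Proof.
move=> [c0 cA cv] dF F0.
have [Fc <-] := is_derive_comp_diff c0 cv dF.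
rewrite derive_mx// mxE (@near_eq_derive _ _ _ _ (fun _ => 0)) ?derive_cst//.
have cc : {for 0, continuous c}.
  by apply: differentiable_continuous; apply/derivable1_diffP; case: cv.
rewrite -c0 in F0.
have nF : \forall t \near (0 : R), A (c t) -> F (c t) ord0 i = 0.
  exact: (cc _ F0).
by apply: filterS2 nF cA => t /=; exact.
Qed.

Definition slice_chart (d : nat) (M U W : set V) (phi psi : V -> V) : Prop :=
  [/\ open U & open W] /\
  [/\ smooth U phi, smooth W psi, set_fun U W phi & set_fun W U psi] /\
  [/\ (forall z, U z -> psi (phi z) = z),
      (forall w, W w -> phi (psi w) = w) &
      (forall z, U z ->
         (M z <-> forall i : 'I_n, (d <= i)%N -> phi z ord0 i = 0))].

Lemma submanifold_chart d (M : set V) x : is_submanifold d M -> M x ->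
  exists U W phi psi, U x /\ slice_chart d M U W phi psi.
Proof.
move=> [_ /[apply]] [U [W [phi [psi [[oU Ux oW] H]]]]].
by exists U, W, phi, psi; split => //; split.
Qed.

Variables (d : nat) (M U W : set V) (phi psi : V -> V).
Hypothesis ch : slice_chart d M U W phi psi.

Let oU : open U. Proof. by case: ch => -[]. Qed.
Let oW : open W. Proof. by case: ch => -[]. Qed.
Let UW z : U z -> W (phi z). Proof. by case: ch => _ [[_ _ H _] _]; exact: H. Qed.
Let WU z : W z -> U (psi z). Proof. by case: ch => _ [[_ _ _ H] _]; exact: H. Qed.
Let C1phi : Ck 1 U phi. Proof. by case: ch => _ [[H _ _ _] _]; exact: H. Qed.
Let C1psi : Ck 1 W psi. Proof. by case: ch => _ [[_ H _ _] _]; exact: H. Qed.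
Let phiK z : U z -> psi (phi z) = z.
Proof. by case: ch => _ [_ [H _ _]]; exact: H. Qed.
Let psiK w : W w -> phi (psi w) = w.
Proof. by case: ch => _ [_ [_ H _]]; exact: H. Qed.
Let MP z : U z -> (M z <-> forall i : 'I_n, (d <= i)%N -> phi z ord0 i = 0).
Proof. by case: ch => _ [_ [_ _ H]]; exact: H. Qed.

Lemma path_slice z v c : U z -> path_through M z v c ->
  forall i : 'I_n, (d <= i)%N -> 'd phi z v ord0 i = 0.
Proof.
move=> Uz zc i di; apply: (path_coord0 zc); first exact: C1phi.1.
apply: filterS (open_nbhs_nbhs (conj oU Uz)) => y Uy /(MP Uy); exact.
Qed.

(** Straight lines in the slice, pulled back by the inverse chart, are the
    smooth curves that realise every admissible velocity. *)
Lemma slice_curve z (u : V) : U z -> M z ->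
  (forall i : 'I_n, (d <= i)%N -> u ord0 i = 0) ->
  is_curve M z ('d psi (phi z) u) (fun t : R => psi (phi z + t *: u)).
Proof.
move=> Uz Mz u0.
have lc : {for (0 : R), continuous (fun t : R => phi z + t *: u)}.
  apply: differentiable_continuous; apply/derivable1_diffP.
  by case: (is_derive_line (phi z) u).
have z0 : phi z + (0 : R) *: u = phi z by rewrite scale0r addr0.
have nW : \forall y \near phi z + (0 : R) *: u, W y.
  by rewrite z0; apply: open_nbhs_nbhs; split => //; exact: UW.
have /nbhs_ballP[e /= e0 eW] : \forall t \near (0 : R), W (phi z + t *: u).
  exact: (lc _ nW).
exists e => //; split.
- by move=> k; apply: Ck_comp_line eW _; case: ch => _ [[_ H _ _] _].
- move=> t /eW Wt; apply/(MP (WU Wt)) => i di.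
  by rewrite psiK// !mxE u0// mulr0 addr0; exact: (MP Uz).1.
- by rewrite z0 phiK.
- apply: (is_derive_comp_diff z0 (is_derive_line (phi z) u)).
  by apply: C1psi.1; exact: UW.
Qed.

(** Velocities of merely differentiable paths are tangent: the chart
    straightens the path, and a line with the same velocity replaces it. *)
Lemma path_tangent z v c : U z -> M z -> path_through M z v c -> tangent M z v.
Proof.
move=> Uz Mz zc; exists (fun t : R => psi (phi z + t *: 'd phi z v)).
rewrite -{1}(@diff_inverse U phi psi z v)//; [|exact: C1phi.1|].
  by apply: slice_curve => //; exact: path_slice zc.
by apply: C1psi.1; exact: UW.
Qed.

Lemma tangent_slice z v : U z -> M z ->
  tangent M z v <-> forall i : 'I_n, (d <= i)%N -> 'd phi z v ord0 i = 0.
Proof.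
move=> Uz Mz; split=> [[c zc]|].
  exact: path_slice (curve_path zc).
move=> /(slice_curve Uz Mz) zc.
exists (fun t : R => psi (phi z + t *: 'd phi z v)).
rewrite -{1}(@diff_inverse U phi psi z v)//; first exact: C1phi.1.
by apply: C1psi.1; exact: UW.
Qed.

(** The differential of the chart is its own differential, and its last
    coordinates vanish along a path in the tangent space. *)
Lemma path_tangent_tangent z v w c : U z -> M z ->
  path_through (tangent M z) v w c -> tangent M z w.
Proof.
move=> Uz Mz vc; apply/(tangent_slice _ Uz Mz) => i di.
have cont : continuous ('d phi z).
  by apply: diff_continuous; exact: C1phi.1.
have <- := diff_lin v cont.
apply: (path_coord0 vc).
  exact: linear_differentiable.
by apply: (filterE (nbhs_filter v)) => u /(tangent_slice _ Uz Mz); exact.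
Qed.

Lemma tangent_rowspace z : U z -> M z ->
  exists A : 'M[R]_n, forall v, tangent M z v <-> (v <= A)%MS.
Proof.
move=> Uz Mz.
(* D kills the first d coordinates, so that the kernel of K is the tangent
   space. *)
pose D : 'M[R]_n := diag_mx (\row_(i < n) (d <= i)%N%:R).
pose K := lin1_mx ('d phi z) *m D.
have vK v i : (v *m K) ord0 i = 'd phi z v ord0 i * (d <= i)%N%:R.
  by rewrite mulmxA mul_rV_lin1 mul_mx_diag !mxE.
exists (kermx K) => v; split=> [/(tangent_slice _ Uz Mz) v0|/sub_kermxP vK0].
  apply/sub_kermxP/rowP => i; rewrite vK mxE.
  by case: leqP => [/v0 ->|]; rewrite ?mul0r ?mulr0.
apply/(tangent_slice _ Uz Mz) => i di.
by have := vK v i; rewrite vK0 di mulr1 mxE.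
Qed.

(** Closedness of the tangent bundle: a coordinate of the differential that
    does not vanish at (z, u) does not vanish nearby. *)
Lemma nontangent_open z u : U z -> M z -> ~ tangent M z u ->
  \forall q \near (z, u), M q.1 -> ~ tangent M q.1 q.2.
Proof.
move=> Uz Mz nzu.
have [i [di ui]] : exists i : 'I_n, (d <= i)%N /\ 'd phi z u ord0 i != 0.
  apply: contrapT => /forallNP nE; apply: nzu; apply/tangent_slice => // i di.
  by apply: contrapT => /eqP ui; apply: (nE i).
have cphi := @C1_diff_continuous R n _ U phi z u oU C1phi Uz.
have ccoord := @coord_continuous R 1 n ord0 i ('d phi z u).
have cc : (fun q : V * V => 'd phi (q.1) q.2 ord0 i) @ (z, u) --> 'd phi z u ord0 i.
  exact: (cvg_comp _ _ cphi ccoord).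
have nU : \forall q \near (z, u), U q.1.
  by apply: (@cvg_fst _ _ (nbhs z) (nbhs u)); exact: open_nbhs_nbhs.
have n0 : \forall q \near (z, u), 'd phi (q.1) q.2 ord0 i != 0.
  exact: cvgr_neq0 cc ui.
apply: filterS2 nU n0 => q Uq q0 Mq /(tangent_slice _ Uq Mq) /(_ i di) /eqP.
exact/negP.
Qed.

(** Freezing the chart coordinates of a tangent vector and moving the base
    point gives a continuous field of tangent vectors. *)
Lemma tangent_extension z w : U z -> M z -> tangent M z w ->
  exists omega : V -> V, [/\ omega z = w, {for z, continuous omega} &
    \forall y \near z, M y -> tangent M y (omega y)].
Proof.
move=> Uz Mz /(tangent_slice _ Uz Mz) w0.
exists (fun y => 'd psi (phi y) ('d phi z w)); split.
- apply: (diff_inverse w oU Uz phiK); first exact: C1phi.1.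
  by apply: C1psi.1; exact: UW.
- have cpsi := @C1_diff_continuous R n _ W psi (phi z) ('d phi z w) oW C1psi (UW Uz).
  have cphi : {for z, continuous phi}.
    by apply: differentiable_continuous; exact: C1phi.1.
  have cp : (fun y => (phi y, 'd phi z w)) @ z --> (phi z, 'd phi z w).
    have cw : (fun _ : V => 'd phi z w) @ z --> 'd phi z w.
      exact: (@cvg_cst _ _ _ _ (nbhs_filter z)).
    exact: (cvg_pair cphi cw).
  exact: (cvg_comp _ _ cp cpsi).
- apply: filterS (open_nbhs_nbhs (conj oU Uz)) => y Uy My.
  by exists (fun t : R => psi (phi y + t *: 'd phi z w)); exact: slice_curve.
Qed.

End Chart.

(** * Inner products on row spaces *)

Section InnerProduct.
Context {R : realType} {n : nat}.
Local Notation V := 'rV[R]_n.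

Definition inner_on (T : set V) (b : V -> V -> R) : Prop :=
  [/\ (forall u v, T u -> T v -> b u v = b v u),
      (forall (a : R) u v w, T u -> T v -> T w ->
         b (a *: u + v) w = a * b u w + b v w) &
      (forall u, T u -> u != 0 -> 0 < b u u)].

Definition linear_on (T : set V) (l : V -> R) : Prop :=
  forall (a : R) u v, T u -> T v -> l (a *: u + v) = a * l u + l v.

Variables (T : set V) (A : 'M[R]_n).
Hypothesis TA : forall v, T v <-> (v <= A)%MS.

Lemma rowspace0 : T 0. Proof. by apply/TA; exact: sub0mx. Qed.

Lemma rowspaceP a u v : T u -> T v -> T (a *: u + v).
Proof. by move=> /TA Tu /TA Tv; apply/TA/addmx_sub => //; exact: scalemx_sub. Qed.

Lemma rowspaceZ a u : T u -> T (a *: u).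
Proof. by move=> /TA Tu; apply/TA; exact: scalemx_sub. Qed.

Lemma rowspaceD u v : T u -> T v -> T (u + v).
Proof. by move=> /TA Tu /TA Tv; apply/TA; exact: addmx_sub. Qed.

Lemma rowspaceN u : T u -> T (- u).
Proof. by rewrite -scaleN1r; exact: rowspaceZ. Qed.

Section Linear.
Variable l : V -> R.
Hypothesis lin : linear_on T l.

Lemma linear_on0 : l 0 = 0.
Proof.
have := lin 1 rowspace0 rowspace0; rewrite scaler0 addr0 mul1r => /eqP.
by rewrite -subr_eq subrr eq_sym => /eqP.
Qed.

Lemma linear_onZ a u : T u -> l (a *: u) = a * l u.
Proof.
by move=> Tu; have := lin a Tu rowspace0; rewrite linear_on0 !addr0.
Qed.

Lemma linear_onD u v : T u -> T v -> l (u + v) = l u + l v.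
Proof. by move=> Tu Tv; have := lin 1 Tu Tv; rewrite scale1r mul1r. Qed.

Lemma linear_onN u : T u -> l (- u) = - l u.
Proof. by move=> Tu; rewrite -scaleN1r linear_onZ// mulN1r. Qed.

Lemma linear_onB u v : T u -> T v -> l (u - v) = l u - l v.
Proof.
by move=> Tu Tv; rewrite linear_onD ?linear_onN//; exact: rowspaceN.
Qed.

Lemma linear_on_sum (I : Type) (r : seq I) (c : I -> R) (u : I -> V) :
  (forall i, T (u i)) ->
  T (\sum_(i <- r) c i *: u i) /\
  l (\sum_(i <- r) c i *: u i) = \sum_(i <- r) c i * l (u i).
Proof.
move=> Tu; elim: r => [|i r [TS lS]].
  by rewrite !big_nil; split; [exact: rowspace0|exact: linear_on0].
by rewrite !big_cons lin// lS; split => //; exact: rowspaceP.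
Qed.

End Linear.

Variable b : V -> V -> R.
Hypothesis bT : inner_on T b.

Let bC u v : T u -> T v -> b u v = b v u. Proof. by case: bT => + _ _; exact. Qed.

Lemma inner_linl w : T w -> linear_on T (fun u => b u w).
Proof. by case: bT => _ + _ => bl Tw a u v Tu Tv; exact: bl. Qed.

Lemma inner_linr w : T w -> linear_on T (b w).
Proof.
move=> Tw a u v Tu Tv; rewrite !(bC Tw)//; last exact: rowspaceP.
exact: inner_linl.
Qed.

Lemma inner_ge0 u : T u -> 0 <= b u u.
Proof.
move=> Tu; have [->|u0] := eqVneq u 0.
  by rewrite (linear_on0 (inner_linl rowspace0)).
by case: bT => _ _ pos; rewrite ltW// pos.
Qed.

Lemma inner_eq0 u : T u -> b u u = 0 -> u = 0.
Proof.
move=> Tu buu; apply/eqP; apply: contraT => u0.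
by case: bT => _ _ /(_ u Tu u0); rewrite buu ltxx.
Qed.

Lemma inner_scale a u : T u -> b (a *: u) (a *: u) = a ^+ 2 * b u u.
Proof.
move=> Tu; have Tau := rowspaceZ a Tu.
by rewrite (linear_onZ (inner_linl Tau))// (linear_onZ (inner_linr Tu))// mulrA.
Qed.

(** Positivity of b (u - t v) (u - t v) at the minimiser t = b u v / b v v. *)
Lemma inner_CS u v : T u -> T v -> b u v ^+ 2 <= b u u * b v v.
Proof.
move=> Tu Tv; have [->|v0] := eqVneq v 0.
  by rewrite !(linear_on0 (inner_linr _))//= ?mulr0 ?expr0n//; exact: rowspace0.
have vv : 0 < b v v by case: bT => _ _; exact.
have [t tv] : exists t, t * b v v = b u v.
  by exists (b u v / b v v); rewrite divfK// gt_eqF.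
have Ttv : T (- (t *: v)) by apply/rowspaceN/rowspaceZ.
have := inner_ge0 (rowspaceD Tu Ttv).
rewrite (linear_onD (inner_linl (rowspaceD Tu Ttv)))//.
rewrite !(linear_onD (inner_linr _))//.
rewrite (bC Ttv Tu) -!scaleNr inner_scale// !(linear_onZ (inner_linr Tu))//.
rewrite sqrrN expr2 -mulrA tv mulNr addNr addr0 => h.
have : 0 <= (b u u - t * b u v) * b v v by rewrite mulr_ge0// ltW.
by rewrite mulrBl mulrAC tv subr_ge0 expr2.
Qed.

(** In a basis of the row space the equation b u = l becomes a linear system
    with the Gram matrix of b, which is invertible because b is definite. *)
Lemma inner_riesz (l : V -> R) : linear_on T l ->
  exists2 u, T u & forall v, T v -> b u v = l v.
Proof.
move=> lin; pose B := row_base A.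
have TB i : T (row i B) by apply/TA; rewrite -(eq_row_base A) row_sub.
pose G := \matrix_(i, j) b (row i B) (row j B).
have cBT c : T (c *m B) by apply/TA; rewrite -(eq_row_base A) submxMl.
have cG c j : b (c *m B) (row j B) = (c *m G) ord0 j.
  rewrite mulmx_sum_row (linear_on_sum (inner_linl (TB j)) _ _ TB).2 mxE.
  by apply: eq_bigr => i _; rewrite mxE.
have uG : G \in unitmx.
  rewrite -row_free_unit; apply: inj_row_free => c cG0.
  have : c *m B = 0.
    apply: inner_eq0 => //; rewrite {2}mulmx_sum_row.
    rewrite (linear_on_sum (inner_linr (cBT c)) _ _ TB).2 big1// => j _.
    by rewrite cG cG0 mxE mulr0.
  by rewrite -(mul0mx _ B) => /(row_free_inj (row_base_free A)).
pose L : 'rV[R]__ := \row_j l (row j B).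
exists (L *m invmx G *m B) => // v Tv.
have /submxP[c ->] : (v <= B)%MS by rewrite eq_row_base; exact/TA.
rewrite (mulmx_sum_row c) (linear_on_sum (inner_linr (cBT _)) _ _ TB).2.
rewrite (linear_on_sum lin _ _ TB).2; apply: eq_bigr => j _.
by rewrite cG mulmxKV// mxE.
Qed.

End InnerProduct.

(** * Differentials and retractions on a submanifold *)

Section Submanifold.
Context {R : realType} {n d : nat}.
Local Notation V := 'rV[R]_n.
Variable M : set V.
Hypothesis subM : is_submanifold d M.

Lemma tangent_space_rowspace x : M x ->
  exists A : 'M[R]_n, forall v, tangent M x v <-> (v <= A)%MS.
Proof.
move=> Mx; have [U [W [phi [psi [Ux ch]]]]] := submanifold_chart subM Mx.
exact: tangent_rowspace ch _ Ux Mx.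
Qed.

Lemma tangent_space_path x v c : M x -> path_through M x v c -> tangent M x v.
Proof.
move=> Mx; have [U [W [phi [psi [Ux ch]]]]] := submanifold_chart subM Mx.
exact: (path_tangent ch Ux Mx).
Qed.

Lemma tangent_of_tangent_space x v w c : M x ->
  path_through (tangent M x) v w c -> tangent M x w.
Proof.
move=> Mx; have [U [W [phi [psi [Ux ch]]]]] := submanifold_chart subM Mx.
exact: (path_tangent_tangent ch Ux Mx).
Qed.

(** A pullback is differentiated along vectors that are tangent to a tangent
    space; they are again tangent to M, because the velocity of a path in a linear
    subspace stays in that subspace. *)
Lemma tangent_tangentE x v w : M x -> tangent M x v ->
  tangent (tangent M x) v w <-> tangent M x w.
Proof.
move=> Mx Tv; split=> [[c /curve_path]|Tw]; first exact: tangent_of_tangent_space.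
have [A TA] := tangent_space_rowspace Mx.
exists (fun t : R => v + t *: w); exists 1 => //; split.
- move=> k; apply: (@Ck_comp_line R _ _ k setT (fun u : V => u) v w 1) => //.
  exact: smooth_id.
- by move=> t _; rewrite addrC; apply: (rowspaceP TA).
- by rewrite scale0r addr0.
- exact: is_derive_line.
Qed.

Section Differential.
Variable f : V -> R.
Hypothesis C1f : Ck_on 1 M f.

Lemma mdiff_extension p : M p -> exists U F, [/\ open U, U p, Ck 1 U F &
  forall z v, U z -> M z -> tangent M z v ->
    mdiff M f z v = 'd F z v :> R].
Proof.
move=> Mp; have [U [F [oU Up C1F Ff]]] := C1f Mp.
exists U, F; split=> // z v Uz Mz Tv.
apply: mdiff_diff => //; first exact: C1F.1.
by apply: filterS (open_nbhs_nbhs (conj oU Uz)) => y; exact: Ff.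
Qed.

Lemma mdiff_path p v c : M p -> path_through M p v c ->
  is_derive (0 : R) (1 : R) (f \o c) (mdiff M f p v).
Proof.
move=> Mp pc; have Tv := tangent_space_path Mp pc.
have [U [F [oU Up C1F Ff]]] := C1f Mp.
have dF : differentiable F p by exact: C1F.1.
have nF : \forall z \near p, M z -> F z = f z.
  by apply: filterS (open_nbhs_nbhs (conj oU Up)) => y; exact: Ff.
by rewrite (mdiff_diff Tv dF nF); exact: path_image dF nF.
Qed.

Lemma mdiff_linear p : M p -> linear_on (tangent M p) (mdiff M f p).
Proof.
move=> Mp a u v Tu Tv; have [A TA] := tangent_space_rowspace Mp.
have [U [F [oU Up C1F dF]]] := mdiff_extension Mp.
by rewrite !dF// ?linearP//; exact: rowspaceP TA _ _ _ Tu Tv.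
Qed.

End Differential.

Section Retraction.
Variable ret : V -> V -> V.
Hypothesis retP : is_retraction M ret.

Lemma retraction_extension z v : M z -> tangent M z v ->
  exists2 F : V -> V, differentiable F v &
    \forall u \near v, tangent M z u -> F u = ret z u.
Proof.
move=> Mz Tv; have [sret retM _ _] := retP.
have [U [F [oU Uzv sF Fret]]] : exists (U : set (V * V)) (F : V * V -> V),
    [/\ open U, U (z, v), smooth U F &
      forall q, U q -> tangent_bundle M q -> F q = ret q.1 q.2].
  by apply: sret; split.
have dpair : differentiable (fun u : V => (z, u)) v.
  by apply: differentiable_pair; [exact: differentiable_cst|exact: ex_diff].
exists (F \o (fun u : V => (z, u))).
  by apply: differentiable_comp => //; apply: (sF 1%N).1.
have cpair := differentiable_continuous dpair.
have nU : \forall u \near v, U (z, u).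
  by apply: (cpair U); exact: open_nbhs_nbhs.
by apply: filterS nU => u Uu Tu /=; rewrite Fret.
Qed.

(** The retraction of a tangent space is differentiable along paths since it
    locally extends to the ambient space; its differential is tangent to M because
    it is the velocity of a path in M. *)
Lemma retraction_path z v w c : M z -> tangent M z v ->
  path_through (tangent M z) v w c ->
  path_through M (ret z v) (mdiff (tangent M z) (ret z) v w) (ret z \o c).
Proof.
move=> Mz Tv vc; have Tw := tangent_of_tangent_space Mz vc.
have [_ retM _ _] := retP.
have [F dF nF] := retraction_extension Mz Tv.
rewrite (mdiff_diff _ dF nF); last exact/tangent_tangentE.
split; [by case: vc => /= -> | |exact: path_image vc dF nF].
by case: vc => _ + _; apply: filterS => t; exact: retM.
Qed.

Lemma retraction_line z v w : M z -> tangent M z v -> tangent M z w ->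
  exists c, path_through (tangent M z) v w c.
Proof.
move=> Mz Tv Tw.
have [c /curve_path vc] : tangent (tangent M z) v w by exact/tangent_tangentE.
by exists c.
Qed.

Lemma retraction_diff_tangent z v w : M z -> tangent M z v -> tangent M z w ->
  tangent M (ret z v) (mdiff (tangent M z) (ret z) v w).
Proof.
move=> Mz Tv Tw; have [c vc] := retraction_line Mz Tv Tw.
apply: tangent_space_path (retraction_path Mz Tv vc).
by case: retP => _ + _ _; exact.
Qed.

(** The chain rule holds at the level of paths: ret z turns a path in the
    tangent space into a path in M, along which f has the derivative given by its
    differential. *)
Lemma mdiff_pullback (f : V -> R) z v w : Ck_on 1 M f ->
  M z -> tangent M z v -> tangent M z w ->
  mdiff (tangent M z) (f \o ret z) v w =
  mdiff M f (ret z v) (mdiff (tangent M z) (ret z) v w).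
Proof.
move=> C1f Mz Tv Tw; apply: mdiff_eq; first exact/tangent_tangentE.
move=> c vc; apply: (mdiff_path C1f (c := ret z \o c)).
  by case: retP => _ + _ _; exact.
exact: retraction_path.
Qed.

Lemma mdiff_retraction_linear z v : M z -> tangent M z v ->
  forall (a : R) u w, tangent M z u -> tangent M z w ->
    mdiff (tangent M z) (ret z) v (a *: u + w) =
    a *: mdiff (tangent M z) (ret z) v u + mdiff (tangent M z) (ret z) v w.
Proof.
move=> Mz Tv a u w Tu Tw; have [A TA] := tangent_space_rowspace Mz.
have [F dF nF] := retraction_extension Mz Tv.
rewrite !(mdiff_diff _ dF nF) ?linearP//; apply/tangent_tangentE => //.
exact: rowspaceP TA _ _ _ Tu Tw.
Qed.

Lemma pullback_linear (f : V -> R) z v : Ck_on 1 M f ->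
  M z -> tangent M z v ->
  linear_on (tangent M z) (mdiff (tangent M z) (f \o ret z) v).
Proof.
move=> C1f Mz Tv a u w Tu Tw; have [A TA] := tangent_space_rowspace Mz.
have Tauw := rowspaceP TA a Tu Tw.
rewrite !mdiff_pullback// mdiff_retraction_linear//.
apply: mdiff_linear => //; try exact: retraction_diff_tangent.
by case: retP => _ + _ _; exact.
Qed.

Lemma retraction_continuous0 p (N : set V) : M p -> nbhs p N ->
  \forall q \near (p, 0 : V), M q.1 -> tangent M q.1 q.2 -> N (ret q.1 q.2).
Proof.
move=> Mp pN; have [sret _ ret0 _] := retP.
have T0 : tangent M p 0.
  by have [A TA] := tangent_space_rowspace Mp; exact: rowspace0 TA.
have [U [F [oU Up sF Fret]]] : exists (U : set (V * V)) (F : V * V -> V),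
    [/\ open U, U (p, 0), smooth U F &
      forall q, U q -> tangent_bundle M q -> F q = ret q.1 q.2].
  by apply: sret; split.
have Fp : F (p, 0) = p by rewrite Fret//= ret0.
have FN : \forall q \near (p, 0 : V), N (F q).
  by apply: (sF 0%N (p, 0) Up); rewrite Fp.
apply: filterS2 (open_nbhs_nbhs (conj oU Up)) FN => q Uq Nq Mq Tq.
by rewrite -Fret.
Qed.

End Retraction.

End Submanifold.

(** * The metric and the gradient near a point *)

(** By the Riesz representation theorem the set from which [riem_grad] chooses
    is not empty, so that its default value is not used.  The tangent space is allowed to be
    presented by another set T, so that the lemma covers both functions on M and
    pullbacks to a tangent space. *)
Lemma riem_gradP {R : realType} {n : nat} (A : set 'rV[R]_n)
    (ip : 'rV[R]_n -> 'rV[R]_n -> 'rV[R]_n -> R) (f : 'rV[R]_n -> R) x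
    (T : set 'rV[R]_n) (B : 'M[R]_n) :
  (forall v, tangent A x v <-> T v) -> (forall v, T v <-> (v <= B)%MS) ->
  inner_on T (ip x) -> linear_on T (mdiff A f x) ->
  T (riem_grad A ip f x) /\
  forall v, T v -> ip x (riem_grad A ip f x) v = mdiff A f x v.
Proof.
move=> AT TB ipT lin; have [u Tu uP] := inner_riesz TB ipT lin.
rewrite /riem_grad; case: xgetP => [y -> [/AT Ty yP]|/(_ u)[]].
  by split => // v /AT; exact: yP.
by split; [exact/AT|move=> v /AT; exact: uP].
Qed.

Section Riemannian.
Context {R : realType} {n d : nat}.
Local Notation V := 'rV[R]_n.
Variables (M : set V) (g : V -> V -> V -> R) (f : V -> R).
Hypothesis Mg : riemannian_submanifold d M g.
Hypothesis C1f : Ck_on 1 M f.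

Let subM : is_submanifold d M. Proof. by case: Mg. Qed.
Let inner x : M x -> inner_on (tangent M x) (g x).
Proof. by case: Mg => _ [+ _] Mx => /(_ x Mx). Qed.

Local Notation grad := (riem_grad M g f).

(** The norm is squared so that the local estimates involve no square roots. *)
Definition grad_sqr z := g z (grad z) (grad z).

Lemma gradP x : M x -> tangent M x (grad x) /\
  forall v, tangent M x v -> g x (grad x) v = mdiff M f x v.
Proof.
move=> Mx; have [A TA] := tangent_space_rowspace subM Mx.
by apply: (@riem_gradP _ _ _ _ _ _ (tangent M x) A) => //; [exact: inner|
  exact: (mdiff_linear subM)].
Qed.

Lemma metric_continuous p u : M p -> tangent M p u -> exists U G,
  [/\ open U, U (p, u), {for (p, u), continuous G} &
    forall q : V * V, U q -> M q.1 -> tangent M q.1 q.2 ->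
      G q = g q.1 q.2 q.2 :> R].
Proof.
move=> Mp Tu; case: Mg => _ [_ sg].
have [U [G [oU Up sG Gg]]] := sg ((p, u), u) (conj Mp (conj Tu Tu)).
(* The metric is smooth on pairs of tangent vectors; D restricts it to the
   diagonal. *)
pose D (q : V * V) := (q, q.2).
have cD : continuous D.
  by move=> q; exact: (cvg_pair (@cvg_id _ (nbhs q)) cvg_snd).
exists (D @^-1` U), (G \o D); split => //.
- by apply: open_comp => // q _; exact: cD.
- have GD : {for D (p, u), continuous G} by exact: (sG 0%N).
  exact: (cvg_comp _ _ (cD (p, u)) GD).
- by move=> q Uq Mq Tq /=; rewrite Gg.
Qed.

Lemma metric_near_gt p u (m : R) : M p -> tangent M p u -> m < g p u u ->
  \forall q \near (p, u), M q.1 -> tangent M q.1 q.2 -> m < g q.1 q.2 q.2.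
Proof.
move=> Mp Tu mg; have [U [G [oU Up cG Gg]]] := metric_continuous Mp Tu.
have Gm : m < G (p, u) by rewrite Gg.
have nG : \forall q \near (p, u), m < G q by exact: (cvgr_gt _ cG).
apply: filterS2 (open_nbhs_nbhs (conj oU Up)) nG.
by move=> q Uq mGq Mq Tq; rewrite -Gg.
Qed.

Lemma metric_near_lt p u (m : R) : M p -> tangent M p u -> g p u u < m ->
  \forall q \near (p, u), M q.1 -> tangent M q.1 q.2 -> g q.1 q.2 q.2 < m.
Proof.
move=> Mp Tu mg; have [U [G [oU Up cG Gg]]] := metric_continuous Mp Tu.
have Gm : G (p, u) < m by rewrite Gg.
have nG : \forall q \near (p, u), G q < m by exact: (cvgr_lt _ cG).
apply: filterS2 (open_nbhs_nbhs (conj oU Up)) nG.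
by move=> q Uq mGq Mq Tq; rewrite -Gg.
Qed.

Lemma mdiff_sqr_continuous p u : M p -> tangent M p u -> exists U G,
  [/\ open U, U (p, u), {for (p, u), continuous G} &
    forall q : V * V, U q -> M q.1 -> tangent M q.1 q.2 ->
      G q = mdiff M f q.1 q.2 ^+ 2 :> R].
Proof.
move=> Mp Tu; have [U [F [oU Up C1F dF]]] := mdiff_extension C1f Mp.
have cdF := @C1_diff_continuous R n _ U F p u oU C1F Up.
exists (fst @^-1` U), (fun q => 'd F (q.1) q.2 ^+ 2); split => //.
- by apply: open_comp => // q _; exact: cvg_fst.
- exact: (cvgM cdF cdF).
- by move=> q Uq Mq Tq; rewrite dF.
Qed.

Lemma mdiff_sqr_near_lt p u (m : R) : M p -> tangent M p u ->
  mdiff M f p u ^+ 2 < m ->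
  \forall q \near (p, u),
    M q.1 -> tangent M q.1 q.2 -> mdiff M f q.1 q.2 ^+ 2 < m.
Proof.
move=> Mp Tu mf; have [U [G [oU Up cG Gf]]] := mdiff_sqr_continuous Mp Tu.
have Gm : G (p, u) < m by rewrite Gf.
have nG : \forall q \near (p, u), G q < m by exact: (cvgr_lt _ cG).
apply: filterS2 (open_nbhs_nbhs (conj oU Up)) nG.
by move=> q Uq mGq Mq Tq; rewrite -Gf.
Qed.

Lemma mdiff_sqr_near_gt p u (m : R) : M p -> tangent M p u ->
  m < mdiff M f p u ^+ 2 ->
  \forall q \near (p, u),
    M q.1 -> tangent M q.1 q.2 -> m < mdiff M f q.1 q.2 ^+ 2.
Proof.
move=> Mp Tu mf; have [U [G [oU Up cG Gf]]] := mdiff_sqr_continuous Mp Tu.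
have Gm : m < G (p, u) by rewrite Gf.
have nG : \forall q \near (p, u), m < G q by exact: (cvgr_gt _ cG).
apply: filterS2 (open_nbhs_nbhs (conj oU Up)) nG.
by move=> q Uq mGq Mq Tq; rewrite -Gf.
Qed.

Lemma sphere_compact : compact [set u : V | `|u| = 1].
Proof.
apply: bounded_closed_compact.
  exists 1; split; first exact: num_real.
  by move=> x x1 u /= ->; exact: ltW.
rewrite (_ : [set _ | _] = Num.norm @^-1` [set 1 : R]) //.
apply: preimage_closed; last exact: closed_eq.
by move=> ? _; exact: norm_continuous.
Qed.

(** Uniformity over unit tangent vectors comes from compactness of the unit
    sphere of the ambient space.  Sphere vectors that are not tangent at p satisfy
    the hypothesis vacuously, by closedness of the tangent bundle. *)
Lemma near_tangent_sphere p (I : Type) (F : set_system I)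
    (P : I -> V -> V -> Prop) : Filter F -> M p ->
  (forall u, tangent M p u -> `|u| = 1 ->
    \forall q \near (p, u) & i \near F,
      M q.1 -> tangent M q.1 q.2 -> P i q.1 q.2) ->
  \forall z \near p & i \near F,
    M z -> forall u, tangent M z u -> `|u| = 1 -> P i z u.
Proof.
move=> FF Mp PP.
(* The base point z joins the index i as the parameter of the covering
   argument, whose compact set is the sphere. *)
pose Q (zi : V * I) u := M zi.1 -> tangent M zi.1 u -> P zi.2 zi.1 u.
have FP : Filter (filter_prod (nbhs p) F) by exact: filter_prod_filter.
have cov u : [set u : V | `|u| = 1] u ->
    \forall u' \near u & zi \near filter_prod (nbhs p) F, Q zi u'.
  move=> u1; have [Tu|nTu] := pselect (tangent M p u).
    have [[A B] /= [[[A1 A2] /= [pA1 uA2] A12] FB] AB] := PP u Tu u1.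
    exists (A2, A1 `*` B); first by split => //; exists (A1, B).
    move=> -[u' [z i]] [/= uA [zA iB]] Mz Tz.
    by apply: (AB ((z, u'), i)) => //; split => //; exact: (A12 (z, u')).
  have [U [W [phi [psi [Up ch]]]]] := submanifold_chart subM Mp.
  have [[A1 A2] /= [pA1 uA2] A12] := nontangent_open ch Up Mp nTu.
  exists (A2, A1 `*` setT).
    by split => //; exists (A1, setT) => //; split => //; exact: filterT.
  move=> -[u' [z i]] [/= uA [zA _]] Mz Tz.
  by have [] := A12 (z, u') (conj zA uA) Mz.
have := (compact_near_coveringP _).1 sphere_compact _ _ Q FP cov.
by apply: filterS => zi KQ Mz u Tu u1; apply: KQ.
Qed.

(** The metric is positive on unit tangent vectors, hence locally bounded
    below on them by compactness, and it is homogeneous. *)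
Lemma metric_lower_bound p : M p -> exists2 m : R, 0 < m &
  \forall z \near p, M z -> forall u, tangent M z u -> m * `|u| ^+ 2 <= g z u u.
Proof.
move=> Mp.
(* The bound m is an index near 0, so that one m serves all unit vectors. *)
have [|[A B] /= [pA B0] AB] :=
    @near_tangent_sphere p R (nbhs (0 : R)) (fun m z u => m <= g z u u) _ Mp.
  move=> u Tu u1; have u0 : u != 0 by rewrite -normr_eq0 u1 oner_eq0.
  have guu : 0 < g p u u by have [_ _] := inner Mp; exact.
  have nA : \forall q \near (p, u), M q.1 -> tangent M q.1 q.2 ->
      g p u u / 2 < g q.1 q.2 q.2.
    by apply: metric_near_gt => //; rewrite ltr_pdivrMr// ltr_pMr// ltr1n.
  have nB : \forall m \near (0 : R), m < g p u u / 2.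
    by apply: lt_nbhsl; rewrite divr_gt0.
  exists ([set q : V * V | M q.1 -> tangent M q.1 q.2 ->
    g p u u / 2 < g q.1 q.2 q.2], [set m | m < g p u u / 2]) => //.
  by move=> -[q m] [/= Hq Hm] Mq Tq; exact: ltW (lt_trans Hm (Hq Mq Tq)).
have /nbhs_ballP[e /= e0 eB] := B0.
have Be : B (e / 2).
  apply: eB; rewrite -ball_normE /ball_ /= sub0r normrN gtr0_norm ?divr_gt0//.
  by rewrite ltr_pdivrMr// ltr_pMr// ltr1n.
exists (e / 2); first by rewrite divr_gt0.
apply: filterS pA => z Az Mz u Tu.
have [C TC] := tangent_space_rowspace subM Mz.
have [->|u0] := eqVneq u 0.
  rewrite normr0 expr0n mulr0.
  exact: (inner_ge0 TC (inner Mz) (rowspace0 TC)).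
have nu0 : `|u| != 0 by rewrite normr_eq0.
have := AB (z, e / 2) (conj Az Be) Mz (`|u|^-1 *: u) (rowspaceZ TC _ Tu).
rewrite normrZ normfV normr_id mulVf// (inner_scale TC (inner Mz))// => /(_ erefl).
by rewrite exprVn [leRHS]mulrC ler_pdivlMr// exprn_gt0// normr_gt0.
Qed.

Lemma grad_sqr_ge0 z : M z -> 0 <= grad_sqr z.
Proof.
move=> Mz; have [A TA] := tangent_space_rowspace subM Mz.
by apply: (inner_ge0 TA (inner Mz)); case: (gradP Mz).
Qed.

(** On unit tangent vectors u near p the squared differential is below
    e * g u u, since it vanishes at p while the metric does not; homogeneity
    extends this to all tangent vectors, and taking u to be the gradient gives the bound. *)
Lemma grad_near_critical p (e : R) : M p -> 0 < e ->
  (forall v, tangent M p v -> mdiff M f p v = 0) ->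
  \forall z \near p, M z -> grad_sqr z <= e.
Proof.
move=> Mp e0 crit.
(* The estimate has no parameter besides z, hence the one-point index set. *)
have [|[A B] /= [pA Btt] AB] := @near_tangent_sphere p unit (globally [set tt])
    (fun _ z u => mdiff M f z u ^+ 2 <= e * g z u u) _ Mp.
  move=> u Tu u1; have u0 : u != 0 by rewrite -normr_eq0 u1 oner_eq0.
  have guu : 0 < g p u u by have [_ _] := inner Mp; exact.
  have nG : \forall q \near (p, u), M q.1 -> tangent M q.1 q.2 ->
      g p u u / 2 < g q.1 q.2 q.2.
    by apply: metric_near_gt => //; rewrite ltr_pdivrMr// ltr_pMr// ltr1n.
  have nF : \forall q \near (p, u), M q.1 -> tangent M q.1 q.2 ->
      mdiff M f q.1 q.2 ^+ 2 < e * (g p u u / 2).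
    by apply: mdiff_sqr_near_lt => //; rewrite crit// expr0n mulr_gt0// divr_gt0.
  exists ([set q : V * V | M q.1 -> tangent M q.1 q.2 ->
    mdiff M f q.1 q.2 ^+ 2 <= e * g q.1 q.2 q.2], setT).
    split => //=; apply: filterS2 nG nF => q Hg Hf Mq Tq.
    by apply: ltW (lt_trans (Hf Mq Tq) _); rewrite ltr_pM2l// Hg.
  by move=> -[q i] [/= + _].
apply: filterS pA => z Az Mz.
have [C TC] := tangent_space_rowspace subM Mz.
have [Tg gE] := gradP Mz; rewrite /grad_sqr.
set w := grad z in Tg gE *.
have [->|w0] := eqVneq w 0.
  rewrite (linear_on0 TC (inner_linl (inner Mz) (rowspace0 TC))).
  exact: ltW.
have nw0 : `|w| != 0 by rewrite normr_eq0.
have gw : 0 < g z w w by have [_ _] := inner Mz; exact.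
have Btt' : B tt by apply: Btt.
have := AB (z, tt) (conj Az Btt') Mz (`|w|^-1 *: w) (rowspaceZ TC _ Tg).
rewrite normrZ normfV normr_id mulVf// (inner_scale TC (inner Mz))// => /(_ erefl).
rewrite (linear_onZ TC (mdiff_linear subM C1f Mz))// -gE// exprMn.
rewrite [leRHS]mulrCA ler_pM2l; last by rewrite exprn_gt0// invr_gt0 normr_gt0.
by rewrite expr2 ler_pM2r.
Qed.

(** A tangent vector on which the differential does not vanish extends to a
    continuous tangent field; Cauchy-Schwarz along this field bounds the gradient
    from below. *)
Lemma grad_near_regular p : M p ->
  (exists2 w, tangent M p w & mdiff M f p w <> 0) ->
  exists2 e : R, 0 < e & \forall z \near p, M z -> e <= grad_sqr z.
Proof.
move=> Mp [w Tw fw].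
have [U [W [phi [psi [Up ch]]]]] := submanifold_chart subM Mp.
have [om [omp com Tom]] := tangent_extension ch Up Mp Tw.
have [A TA] := tangent_space_rowspace subM Mp.
have g0 := inner_ge0 TA (inner Mp) Tw.
have f0 : 0 < mdiff M f p w ^+ 2 by rewrite exprn_even_gt0//=; exact/eqP.
set a := mdiff M f p w ^+ 2 / 2; set b := g p w w + 1.
have a0 : 0 < a by rewrite divr_gt0.
have b0 : 0 < b by rewrite ltr_wpDl.
exists (a / b); first by rewrite divr_gt0.
have cp : (fun z => (z, om z)) @ p --> (p, w).
  have com' : om @ p --> w by rewrite -[X in _ --> X]omp; exact: com.
  exact: (cvg_pair (@cvg_id _ (nbhs p)) com').
have nG : \forall z \near p, M z -> tangent M z (om z) -> g z (om z) (om z) < b.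
  by apply: (cp _ (metric_near_lt Mp Tw _)); rewrite ltrDl.
have nF : \forall z \near p, M z -> tangent M z (om z) ->
    a < mdiff M f z (om z) ^+ 2.
  apply: (cp _ (mdiff_sqr_near_gt Mp Tw _)).
  by rewrite ltr_pdivrMr// ltr_pMr// ltr1n.
apply: filterS3 Tom nG nF => z Tz Gz Fz Mz.
have Tomz := Tz Mz; have {}Gz := Gz Mz Tomz; have {}Fz := Fz Mz Tomz.
have [B TB] := tangent_space_rowspace subM Mz.
have [Tg gE] := gradP Mz.
rewrite ler_pdivrMr//; apply: ltW (lt_le_trans Fz _).
rewrite -gE//; apply: le_trans (inner_CS TB (inner Mz) Tg Tomz) _.
by rewrite ler_wpM2l ?grad_sqr_ge0// ltW.
Qed.

End Riemannian.

(** * Gradient steps *)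

Section Steps.
Context {R : realType} {n d : nat}.
Local Notation V := 'rV[R]_n.
Variables (M : set V) (g : V -> V -> V -> R) (f : V -> R).
Variable ret : V -> V -> V.
Hypothesis Mg : riemannian_submanifold d M g.
Hypothesis C1f : Ck_on 1 M f.
Hypothesis retP : is_retraction M ret.

Let subM : is_submanifold d M. Proof. by case: Mg. Qed.
Let inner x : M x -> inner_on (tangent M x) (g x).
Proof. by case: Mg => _ [+ _] Mx => /(_ x Mx). Qed.

Local Notation grad := (riem_grad M g f).
Local Notation grad_sqr := (grad_sqr M g f).

(** Near a point that is not critical the gradient is bounded below, so that
    no z qualifies once dl is small.  Near a critical point the vector
    a *: - grad z is small in the ambient norm, because the metric controls that
    norm, and the retraction is continuous at the zero vector. *)
Lemma gradient_step_near p (e amax : R) : M p -> 0 < e -> 0 < amax ->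
  \forall z \near p & dl \near (0 : R), M z -> grad_sqr z < dl ->
    forall a, 0 <= a <= amax -> grad_sqr (ret z (a *: - grad z)) <= e.
Proof.
move=> Mp e0 amax0.
have [crit|] := pselect (forall v, tangent M p v -> mdiff M f p v = 0); last first.
  move=> /existsNP[w /not_implyP[Tw fw]].
  have [//|e1 e10 ne1] := @grad_near_regular _ _ _ M g f Mg C1f p Mp.
    by exists w.
  have ndl : \forall dl \near (0 : R), dl < e1 by exact: lt_nbhsl.
  exists ([set z | M z -> e1 <= grad_sqr z], [set dl | dl < e1]) => //.
  move=> -[z dl] [/= Hz dle1] Mz zdl.
  by have := lt_trans (le_lt_trans (Hz Mz) zdl) dle1; rewrite ltxx.
have ne := grad_near_critical Mg C1f Mp e0 crit.
have [m m0 nm] := metric_lower_bound Mg Mp.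
have [[A B] /= [pA B0] AB] := retraction_continuous0 subM retP Mp ne.
have /nbhs_ballP[r /= r0 rB] := B0.
(* With grad_sqr z < b, the ambient norm of a *: grad z is below r for
   a <= amax. *)
pose b := r ^+ 2 * m / amax ^+ 2.
have b0 : 0 < b by rewrite divr_gt0 ?mulr_gt0 ?exprn_gt0.
have ndl : \forall dl \near (0 : R), dl < b by exact: lt_nbhsl.
have nzA : \forall z \near p, A z /\
    (M z -> forall u, tangent M z u -> m * `|u| ^+ 2 <= g z u u).
  exact: filterI.
exists ([set z | A z /\
  (M z -> forall u, tangent M z u -> m * `|u| ^+ 2 <= g z u u)],
  [set dl | dl < b]) => //.
move=> -[z dl] [/= [Az Hm] dlb] Mz zdl a /andP[a0 aM].
have [C TC] := tangent_space_rowspace subM Mz.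
have [Tg _] := gradP Mg C1f Mz.
have Ts : tangent M z (a *: - grad z) by apply/(rowspaceZ TC)/(rowspaceN TC).
apply: (AB (z, a *: - grad z)) => //=; last by case: retP => _ + _ _; exact.
split => //; apply: rB; rewrite -ball_normE /ball_ /= sub0r normrN.
rewrite normrZ normrN ger0_norm//.
rewrite -(@ltr_pXn2r _ 2)// ?nnegrE ?mulr_ge0// ?ltW// exprMn.
have mg := Hm Mz _ Tg.
have : `|grad z| ^+ 2 < r ^+ 2 / amax ^+ 2.
  rewrite -(ltr_pM2l m0); apply: le_lt_trans mg _.
  apply: lt_trans zdl _; apply: lt_le_trans dlb _.
  by rewrite /b mulrA [m * _]mulrC.
rewrite ltr_pdivlMr ?exprn_gt0// => gr; apply: le_lt_trans gr.
by rewrite mulrC ler_wpM2l ?exprn_ge0// ler_pXn2r// ?nnegrE// ltW.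
Qed.

(** Compactness makes the threshold dl of the local statement uniform. *)
Lemma gradient_step_compact (K : set V) (e amax : R) :
  compact K -> K `<=` M -> 0 < e -> 0 < amax ->
  exists2 dl : R, 0 < dl & forall z, K z -> grad_sqr z < dl ->
    forall a, 0 <= a <= amax -> grad_sqr (ret z (a *: - grad z)) <= e.
Proof.
move=> cK KM e0 amax0.
pose P (dl : R) z := M z -> grad_sqr z < dl ->
    forall a, 0 <= a <= amax -> grad_sqr (ret z (a *: - grad z)) <= e.
have /nbhs_ballP : \forall dl \near (0 : R), K `<=` P dl.
  have cov p : K p -> \forall z \near p & dl \near (0 : R), P dl z.
    by move=> Kp; exact: gradient_step_near (KM p Kp) e0 amax0.
  have cK' := (compact_near_coveringP K).1 cK.
  exact: (cK' R (nbhs (0 : R)) P _ cov).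
move=> [r /= r0 rP]; exists (r / 2); first by rewrite divr_gt0.
move=> z Kz; apply: (rP (r / 2)) => //; last exact: KM.
rewrite -ball_normE /ball_ /= sub0r normrN gtr0_norm ?divr_gt0//.
by rewrite ltr_pdivrMr// ltr_pMr// ltr1n.
Qed.

(** The Lipschitz condition speaks of the gradient of the pullback, the curvature
    condition of the differential of f composed with that of the retraction. *)
Lemma pullback_gradP z v : M z -> tangent M z v ->
  tangent M z (riem_grad (tangent M z) (fun _ => g z) (f \o ret z) v) /\
  forall w, tangent M z w ->
    g z (riem_grad (tangent M z) (fun _ => g z) (f \o ret z) v) w =
    mdiff M f (ret z v) (mdiff (tangent M z) (ret z) v w).
Proof.
move=> Mz Tv; have [A TA] := tangent_space_rowspace subM Mz.
have [||||Tg gE] := @riem_gradP R n (tangent M z) (fun _ => g z) (f \o ret z) v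
    (tangent M z) A.
- by move=> w; exact: (tangent_tangentE subM w Mz Tv).
- exact: TA.
- exact: inner.
- exact: (pullback_linear subM retP C1f Mz Tv).
by split => // w Tw; rewrite gE// (mdiff_pullback subM retP C1f).
Qed.

(** Write s for the squared gradient norm.  The curvature condition makes the
    pullback gradient, paired with the direction, change by at least (1 - c2) * s
    over the step; the Lipschitz bound and Cauchy-Schwarz make it change by at most
    L * a * s.  Hence a >= (1 - c2) / L, and sufficient decrease concludes. *)
Lemma wolfe_gradient_decrease z (a L c1 c2 : R) :
  M z -> grad z <> 0 -> 0 < a -> 0 < L -> 0 < c1 -> c2 < 1 ->
  (forall v1 v2, tangent M z v1 -> tangent M z v2 ->
     let grad_pullback v :=
       riem_grad (tangent M z) (fun _ => g z) (f \o ret z) v in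
     gnorm g z (grad_pullback v1 - grad_pullback v2) <= L * gnorm g z (v1 - v2)) ->
  let y := ret z (a *: - grad z) in
  f y - f z <= c1 * a * g z (grad z) (- grad z) ->
  c2 * g z (grad z) (- grad z) <=
    g y (grad y) (mdiff (tangent M z) (ret z) (a *: - grad z) (- grad z)) ->
  c1 * ((1 - c2) / L) * grad_sqr z <= f z - f y.
Proof.
move=> Mz g0 a0 L0 c10 c21 lip y armijo curv.
have [A TA] := tangent_space_rowspace subM Mz.
have [Tg gE] := gradP Mg C1f Mz.
have TNg := rowspaceN TA Tg; have Tag := rowspaceZ TA a TNg.
have T0 := rowspace0 TA.
have [_ retM ret0 dret0] := retP.
have My : M y by exact: retM.
have [Tp0 p0E] := pullback_gradP Mz T0.
have [Tpa paE] := pullback_gradP Mz Tag.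
have := lip _ _ Tag T0; rewrite /= subr0.
set p0 := riem_grad _ _ _ 0 in Tp0 p0E *.
set pa := riem_grad _ _ _ (a *: _) in Tpa paE *.
have gN : g z (grad z) (- grad z) = - grad_sqr z.
  by rewrite (linear_onN TA (inner_linr TA (inner Mz) Tg)).
have gNN : g z (- grad z) (- grad z) = grad_sqr z.
  rewrite (linear_onN TA (inner_linr TA (inner Mz) TNg))//.
  by rewrite (linear_onN TA (inner_linl (inner Mz) Tg))// opprK.
have s0 : 0 < grad_sqr z by have [_ _] := inner Mz; apply => //; exact/eqP.
have h0 : g z p0 (- grad z) = - grad_sqr z.
  by rewrite p0E// ret0// dret0// -gE.
have ha : - c2 * grad_sqr z <= g z pa (- grad z).
  rewrite paE// -/y mulNr -mulrN -gN; apply: le_trans curv _.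
  have [_ yE] := gradP Mg C1f My.
  by rewrite yE//; exact: (retraction_diff_tangent subM retP).
have TD : tangent M z (pa - p0) by apply: (rowspaceD TA) => //; exact: (rowspaceN TA).
have hD : (1 - c2) * grad_sqr z <= g z (pa - p0) (- grad z).
  rewrite (linear_onB TA (inner_linl (inner Mz) TNg))// h0; lra.
have CS := inner_CS TA (inner Mz) TD TNg; rewrite gNN in CS.
have D0 := inner_ge0 TA (inner Mz) TD.
rewrite /gnorm (inner_scale TA (inner Mz))// gNN => lipD.
have {}lipD : g z (pa - p0) (pa - p0) <= L ^+ 2 * (a ^+ 2 * grad_sqr z).
  have as0 : 0 <= a ^+ 2 * grad_sqr z by rewrite mulr_ge0 ?exprn_ge0// ltW.
  rewrite -(sqr_sqrtr D0) -[X in _ * X](sqr_sqrtr as0) -exprMn.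
  by rewrite ler_pXn2r// nnegrE ?mulr_ge0 ?sqrtr_ge0// ltW.
have step : 1 - c2 <= L * a.
  rewrite -(@ler_pXn2r _ 2)// ?nnegrE ?subr_ge0 ?mulr_ge0 ?(ltW L0) ?(ltW a0) ?(ltW c21)//.
  have s20 : 0 < grad_sqr z ^+ 2 by rewrite exprn_gt0.
  rewrite -(ler_pM2r s20) -exprMn.
  apply: le_trans (_ : g z (pa - p0) (- grad z) ^+ 2 <= _).
    rewrite ler_pXn2r// nnegrE; last apply: le_trans hD;
      by rewrite mulr_ge0 ?subr_ge0// ltW.
  apply: le_trans CS _.
  have -> : (L * a) ^+ 2 * grad_sqr z ^+ 2 =
      L ^+ 2 * (a ^+ 2 * grad_sqr z) * grad_sqr z by ring.
  by rewrite ler_pM2r.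
rewrite gN in armijo.
have step' : (1 - c2) / L <= a by rewrite ler_pdivrMr// mulrC.
apply: (@le_trans _ _ (c1 * a * grad_sqr z)); last lra.
by rewrite ler_pM2r// ler_pM2l.
Qed.

End Steps.

(** * Convergence *)

(** A decreasing sequence that is bounded below converges, so its gaps vanish. *)
Lemma decreasing_gap_small {R : realType} (u : nat -> R) (m e : R) :
  (forall k, u k.+1 <= u k) -> (forall k, m <= u k) -> 0 < e ->
  \forall k \near \oo, u k - u k.+1 < e.
Proof.
move=> udec um e0.
have cu : cvgn u.
  apply: nonincreasing_is_cvgn; first exact/nonincreasing_seqP.
  by exists m => _ [k _ <-].
have : (fun k => u k - u k.+1) @ \oo --> (0 : R).
  rewrite -(subrr (limn u)); apply: cvgB => //.
  by rewrite (cvg_shiftS u).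
by move=> /cvgr_lt; exact.
Qed.

Theorem theorem5p1 (R : realType) (nh dh nH dH : nat)
    (Mh : set 'rV[R]_nh) (gh : 'rV[R]_nh -> 'rV[R]_nh -> 'rV[R]_nh -> R)
    (MH : set 'rV[R]_nH) (gH : 'rV[R]_nH -> 'rV[R]_nH -> 'rV[R]_nH -> R)
    (fh : 'rV[R]_nh -> R) (fH : 'rV[R]_nH -> R)
    (reth : 'rV[R]_nh -> 'rV[R]_nh -> 'rV[R]_nh)
    (retH : 'rV[R]_nH -> 'rV[R]_nH -> 'rV[R]_nH)
    (UH : 'rV[R]_nH -> set 'rV[R]_nH)
    (liftH : 'rV[R]_nH -> 'rV[R]_nH -> 'rV[R]_nH)
    (C : 'rV[R]_nH -> set 'rV[R]_nH)
    (dom : set 'rV[R]_nh) (r : 'rV[R]_nh -> 'rV[R]_nH)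
    (P : 'rV[R]_nH -> 'rV[R]_nh -> 'rV[R]_nH -> 'rV[R]_nh)
    (Rs : 'rV[R]_nh -> 'rV[R]_nH -> 'rV[R]_nh -> 'rV[R]_nH)
    (eta mu c1 c2 : R)
    (x d : nat -> 'rV[R]_nh) (alpha : nat -> R)
    (hMh : riemannian_submanifold dh Mh gh)
    (hMH : riemannian_submanifold dH MH gH)
    (hfh : Ck_on 1 Mh fh) (hfH : Ck_on 1 MH fH)
    (hreth : is_retraction Mh reth) (hretH : is_retraction MH retH)
    (hlift : is_lifting MH retH UH liftH)
    (hC : forall k, [/\ C (r (x k)) `<=` UH (r (x k)), C (r (x k)) (r (x k)) &
                        retraction_convex MH retH UH liftH (C (r (x k)))])
    (hr : point_restriction Mh MH dom r)
    (hPR : vector_transfer Mh gh MH gH P Rs)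
    (heta : 0 < eta < 1) (hmu : 0 < mu)
    (hrun : two_level_run Mh gh fh reth MH gH fH liftH C dom r P Rs eta mu
                          x d alpha)
    (A1 : forall x0, Mh x0 -> compact [set z | Mh z /\ fh z <= fh x0])
    (A2 : exists m : R, forall z, Mh z -> m <= fh z)
    (A3 : exists2 L : R, 0 < L &
       forall z, Mh z -> fh z <= fh (x 0%N) ->
       forall v1 v2, tangent Mh z v1 -> tangent Mh z v2 ->
         let grad_pullback v :=
           riem_grad (tangent Mh z) (fun _ => gh z) (fh \o reth z) v in
         gnorm gh z (grad_pullback v1 - grad_pullback v2)
           <= L * gnorm gh z (v1 - v2))
    (hc : 0 < c1 < c2) (hc2 : c2 < 1)
    (A4 : forall k,
       fh (x k.+1) - fh (x k)
         <= c1 * alpha k * gh (x k) (riem_grad Mh gh fh (x k)) (d k) /\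
       gh (x k.+1) (riem_grad Mh gh fh (x k.+1))
          (mdiff (tangent Mh (x k)) (reth (x k)) (alpha k *: d k) (d k))
         >= c2 * gh (x k) (riem_grad Mh gh fh (x k)) (d k))
    (A5 : exists2 alpha_max : R, 0 < alpha_max &
       forall k, d k = - riem_grad Mh gh fh (x k) -> alpha k <= alpha_max) :
  (fun k => gnorm gh (x k) (riem_grad Mh gh fh (x k))) @ \oo --> (0 : R).
Proof.
have [domM _ _ _ _] := hr; have [dom0 run] := hrun.
have xdom k : dom (x k) by case: k => [//|k]; have [_ _ _ []] := run k.
have xM k : Mh (x k) by exact: domM.
have xE k : x k.+1 = reth (x k) (alpha k *: d k) by have [_ _ _ []] := run k.
have fdec k : fh (x k.+1) < fh (x k) by have [_ _ _ []] := run k.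
have f0 k : fh (x k) <= fh (x 0%N).
  by elim: k => [//|k]; apply: le_trans; exact: ltW.
have [L L0 lip] := A3; have [amax amax0 aM] := A5; have [m fm] := A2.
have [c10 c12] := andP hc.
pose a k := grad_sqr Mh gh fh (x k).
pose c := c1 * ((1 - c2) / L).
have c0 : 0 < c by rewrite mulr_gt0// divr_gt0// subr_gt0.
have gstep k : d k = - riem_grad Mh gh fh (x k) ->
    c * a k <= fh (x k) - fh (x k.+1).
  move=> dk; have [g0 _ _ [alpha0 _ _ _]] := run k.
  have [armijo curv] := A4 k.
  have xk1 : x k.+1 = reth (x k) (alpha k *: - riem_grad Mh gh fh (x k)).
    by rewrite xE dk.
  rewrite xk1 dk in armijo curv *.
  apply: (wolfe_gradient_decrease hMh hfh hreth (xM k) g0 alpha0 L0 c10 hc2) => //.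
  by move=> v1 v2; exact: (lip _ (xM k) (f0 k) v1 v2).
(* A step other than a gradient step comes from a coarse model condition that
   holds, which requires the preceding step to be a gradient step. *)
have step k : d k.+1 <> - riem_grad Mh gh fh (x k.+1) ->
    d k = - riem_grad Mh gh fh (x k).
  have [_ _ gradient _] := run k.+1.
  by move=> nd; apply: contrapT => ndk; apply/nd/gradient => -[_ /(_ k erefl)].
apply/cvgrPdist_le => e e0.
have e20 : 0 < e ^+ 2 by rewrite exprn_gt0.
have KM : [set z | Mh z /\ fh z <= fh (x 0%N)] `<=` Mh by move=> z [].
have [dl dl0 small] :=
  gradient_step_compact hMh hfh hreth (A1 _ (xM 0%N)) KM e20 amax0.
have gap : \forall k \near \oo, fh (x k) - fh (x k.+1) < c * Num.min dl (e ^+ 2).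
  apply: (@decreasing_gap_small R (fun k => fh (x k)) m) => [k|k|].
  - exact: ltW.
  - exact: fm.
  - by rewrite mulr_gt0// lt_min dl0.
have [N _ gapN] := gap.
(* The index is shifted by one so that the preceding iterate is also beyond N. *)
exists N.+1 => // -[//|k] /= Nk.
rewrite sub0r normrN ger0_norm ?sqrtr_ge0// -(ger0_norm (ltW e0)) -sqrtr_sqr.
apply: ler_wsqrtr; rewrite -/(grad_sqr Mh gh fh (x k.+1)).
have asmall j : (N <= j)%N -> d j = - riem_grad Mh gh fh (x j) ->
    a j < Num.min dl (e ^+ 2).
  move=> Nj dj; rewrite -(ltr_pM2l c0).
  exact: le_lt_trans (gstep j dj) (gapN j Nj).
have [dk|ndk] := pselect (d k.+1 = - riem_grad Mh gh fh (x k.+1)).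
  have := asmall k.+1 (leqW Nk) dk; rewrite lt_min => /andP[_ /ltW]; exact.
have dk := step k ndk.
have := asmall k Nk dk; rewrite lt_min => /andP[ak _].
have [_ _ _ [alpha0 _ _ _]] := run k.
rewrite xE dk; apply: small ak _ _; first by split; [exact: xM|exact: f0].
by rewrite ltW//= aM.
Qed.
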